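(* Assume that for every $t$ the local noises $w^1_t,\ldots,w^n_t$ are exchangeable, and let $c_{\max}$ be an upper bound on the per-step cost $c$. Given $\varepsilon>0$, let $k=k(\varepsilon)\in\mathbb{N}$ satisfy $k\ge \log\!\big(\tfrac{(1-\gamma)\varepsilon}{2c_{\max}}\big)/\log(\gamma)$. Fix an arbitrary $m^\ast\in\mathcal{M}(n)$ and let $\tilde V_k:\mathcal{M}(n)\times\{0,1,\ldots,k\}\to\mathbb{R}$ be any solution of $\tilde V_k(x,y)=\min(\tilde V^0_k(x,y),\tilde V^1_k(x,y))$, where $$\tilde V^0_k(x,y)=\sum_{m\in\mathcal{M}(n)}c\big(m,h(T_{\mathsf m}^y(\cdot,x)),0\big)T_{\mathsf m}^y(m,x)+\gamma\big(\mathbb{1}\{y<k\}\tilde V_k(x,y+1)+\mathbb{1}\{y=k\}\tilde V_k(m^\ast,0)\big),$$ $$\tilde V^1_k(x,y)=\sum_{m\in\mathcal{M}(n)}c\big(m,h(T_{\mathsf m}^y(\cdot,x)),1\big)T_{\mathsf m}^y(m,x)+(1-q)\gamma\big(\mathbb{1}\{y<k\}\tilde V_k(x,y+1)+\mathbb{1}\{y=k\}\tilde V_k(m^\ast,0)\big)+q\gamma\sum_{m'\in\mathcal{M}(n)}T_{\mathsf m}^{y+1}(m',x)\tilde V_k(m',0).$$ Then the strategy $g^\ast_\varepsilon(x,y)=0$ if $\tilde V^0_k(x,y)\le\tilde V^1_k(x,y)$ and $g^\ast_\varepsilon(x,y)=1$ otherwise (applied to $(x_t,y_t)$) is $\varepsilon$-optimal: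 $J(g^\ast_\varepsilon)\le J(g)+\varepsilon$ for every strategy $g$.
   Context: Setting: $n\in\mathbb{N}$ nodes, finite state set $\mathcal{S}\subset\mathbb{R}$, finite noise set $\mathcal{W}\subset\mathbb{R}$, time $t\in\mathbb{N}=\{1,2,\ldots\}$. Node $i$ has state $s^i_t\in\mathcal{S}$; the empirical distribution is $m_t(s)=\frac1n\sum_{i=1}^n\mathbb{1}\{s^i_t=s\}$, taking values in $\mathcal{M}(n)$, the set of probability vectors on $\mathcal{S}$ with entries in $\{0,\frac1n,\ldots,1\}$. States evolve as $s^i_{t+1}=f(s^i_t,m_t,w^i_t)$ with local noise $w^i_t\in\mathcal{W}$. A decision maker picks $a_t\in\{0,1\}$ ($1$ = collect data). Observations $o_t\in\mathcal{O}=\mathcal{M}(n)\cup\{\mathtt{blank}\}$: $o_1=m_1$; if $a_t=0$ then $o_{t+1}=\mathtt{blank}$; if $a_t=1$ then $o_{t+1}=m_{t+1}$ with probability $q\in[0,1]$ and $o_{t+1}=\mathtt{blank}$ with probability $1-q$. A strategy is $g=(g_1,g_2,\ldots)$, $a_t=g_t(o_{1:t},a_{1:t-1})$. Initial states, noise vectors, and the Bernoulli($q$) credibility variables are mutually independent with finite variances. The estimate is $\hat m_t=h(\mathbb{P}(m_t\mid o_{1:t},a_{1:t-1}))\in\mathcal{M}(n)$ for a fixed function $h$. Per-step cost $c:\mathcal{M}(n)^2\times\{0,1\}\to\mathbb{R}_{\ge0}$ at $(m_t,\hat m_t,a_t)$; discount $\gamma\in(0,1)$; $J(g)=\mathbb{E}^g[\sum_{t=1}^\infty\gamma^{t-1}c(m_t,\hat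 m_t,a_t)]$. Under exchangeable noises $m_t$ is a time-homogeneous Markov chain with transition matrix $T_{\mathsf m}(m',m)=\mathbb{P}(m_{t+1}=m'\mid m_t=m)$; $T_{\mathsf m}^y$ is its $y$-th power. $x_t$ is the last non-blank observation up to time $t$ and $y_t$ the number of blank observations since then, $(x_1,y_1)=(m_1,0)$.
   Formalization: The strategy is defined in the text only for y ≤ k; here, when y_t > k, it acts as at y = k. The noise vectors are taken independent over time with one common exchangeable law, so that the time-homogeneous transition matrix is well defined. *)

(* Defs.v *)
From HB Require Import structures.
From mathcomp Require Import all_boot all_order all_algebra all_fingroup.
From mathcomp Require Import all_classical all_reals all_analysis.
Set Implicit Arguments. Unset Strict Implicit. Unset Printing Implicit Defensive.
Import Order.TTheory GRing.Theory Num.Theory numFieldNormedType.Exports.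
Local Open Scope ring_scope.

(* An element of M(n) is encoded by its vector of counts n*m(s) (entries in
   {0,..,n}, summing to n); m(s) = count(s)/n. *)
Definition Mn (S : finType) (n : nat) :=
  {m : {ffun S -> 'I_n.+1} | \sum_(x : S) (m x : nat) == n}.

Definition cnt (S : finType) (n : nat) (s : {ffun 'I_n -> S}) : {ffun S -> 'I_n.+1} :=
  [ffun x => inord #|[pred i | s i == x]|].

Lemma cnt_sum (S : finType) (n : nat) (s : {ffun 'I_n -> S}) :
  \sum_(x : S) (cnt s x : nat) == n.
Proof.
apply/eqP.
have E x : (cnt s x : nat) = \sum_(i < n) (s i == x : nat).
  rewrite ffunE inordK; last by rewrite ltnS (leq_trans (max_card _)) ?card_ord.
  by rewrite -sum1_card big_mkcond /=.
rewrite (eq_bigr _ (fun x _ => E x)) exchange_big /=.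
rewrite -[RHS]card_ord -sum1_card; apply: eq_bigr => i _.
by rewrite (bigD1 (s i)) //= eqxx big1 ?addn0 // => x /negPf; rewrite eq_sym => ->.
Qed.

Definition emp (S : finType) (n : nat) (s : {ffun 'I_n -> S}) : Mn S n :=
  exist _ (cnt s) (cnt_sum s).

(* observations: None = blank, Some m = m *)
Definition obs (S : finType) (n : nat) := option (Mn S n).

Section Model.
Variables (R : realType) (S W : finType) (n : nat).
Variable f : S -> Mn S n -> W -> S.
Variable P0 : {ffun 'I_n -> S} -> R.
Variable PW : {ffun 'I_n -> W} -> R.
Variable q : R.

Definition next (s : {ffun 'I_n -> S}) (w : {ffun 'I_n -> W}) : {ffun 'I_n -> S} :=
  [ffun i => f (s i) (emp s) (w i)].

Definition obs_dist (a : bool) (m : Mn S n) : seq (R * obs S n) :=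
  if a then [:: (q, Some m); (1 - q, None)] else [:: (1, None)].

(* strategies: a_t = g t (o_{1:t}) (a_{1:t-1}), time 0-indexed (t = 0 is time 1) *)
Definition strategy := nat -> seq (obs S n) -> seq bool -> bool.

Definition config := ({ffun 'I_n -> S} * seq (obs S n) * seq bool)%type.

(* joint law of (s_t, o_{1:t}, a_{1:t-1}) as a finite weighted list *)
Fixpoint law (g : strategy) (t : nat) : seq (R * config) :=
  match t with
  | 0 => [seq (P0 s, (s, [:: Some (emp s)], [::])) | s <- enum {: {ffun 'I_n -> S}}]
  | t'.+1 =>
    flatten [seq
      let: (p, (s, oh, ah)) := pc in
      let a := g t' oh ah in
      flatten [seq [seq (p * PW w * po.1, (next s w, rcons oh po.2, rcons ah a))
                   | po <- obs_dist a (emp (next s w))]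
              | w <- enum {: {ffun 'I_n -> W}}]
    | pc <- law g t']
  end.

(* posterior P(m_t = . | o_{1:t} = oh, a_{1:t-1} = ah)  (0/0 := 0) *)
Definition post (g : strategy) (t : nat) (oh : seq (obs S n)) (ah : seq bool)
  : {ffun Mn S n -> R} :=
  [ffun m =>
     (\sum_(pc <- law g t | (emp pc.2.1.1 == m) && (pc.2.1.2 == oh) && (pc.2.2 == ah)) pc.1)
     / (\sum_(pc <- law g t | (pc.2.1.2 == oh) && (pc.2.2 == ah)) pc.1)].

Variable c : Mn S n -> Mn S n -> bool -> R.
Variable h : {ffun Mn S n -> R} -> Mn S n.
Variable gamma : R.

Definition Ecost (g : strategy) (t : nat) : R :=
  \sum_(pc <- law g t)
     pc.1 * c (emp pc.2.1.1) (h (post g t pc.2.1.2 pc.2.2)) (g t pc.2.1.2 pc.2.2).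

Definition J (g : strategy) : R :=
  limn (series (fun t => gamma ^+ t * Ecost g t)).

(* transition matrix of m_t : T(m', m) = P(m_{t+1} = m' | m_t = m), computed
   (as an average, which is exact under exchangeable noise) over the joint
   states whose empirical distribution is m *)
Definition Tm (m' m : Mn S n) : R :=
  (\sum_(s : {ffun 'I_n -> S} | emp s == m)
      \sum_(w : {ffun 'I_n -> W}) PW w * (emp (next s w) == m')%:R)
  / (#|[pred s : {ffun 'I_n -> S} | emp s == m]|)%:R.

Fixpoint Tpow (y : nat) (m' x : Mn S n) : R :=
  match y with
  | 0 => (m' == x)%:R
  | y'.+1 => \sum_(m'' : Mn S n) Tm m' m'' * Tpow y' m'' x
  end.

Variables (k : nat) (mstar : Mn S n).

Definition contV (V : Mn S n -> nat -> R) (x : Mn S n) (y : nat) : R :=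
  (y < k)%N%:R * V x y.+1 + (y == k)%:R * V mstar 0%N.

Definition V0 (V : Mn S n -> nat -> R) (x : Mn S n) (y : nat) : R :=
  \sum_(m : Mn S n) c m (h [ffun m1 => Tpow y m1 x]) false * Tpow y m x
  + gamma * contV V x y.

Definition V1 (V : Mn S n -> nat -> R) (x : Mn S n) (y : nat) : R :=
  \sum_(m : Mn S n) c m (h [ffun m1 => Tpow y m1 x]) true * Tpow y m x
  + (1 - q) * gamma * contV V x y
  + q * gamma * \sum_(m' : Mn S n) Tpow y.+1 m' x * V m' 0%N.

(* (x_t, y_t): last non-blank observation and number of blanks since then;
   the fallback (never reached, since o_1 is non-blank) is mstar *)
Fixpoint xy_rev (l : seq (obs S n)) : Mn S n * nat :=
  match l with
  | [::] => (mstar, 0%N)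
  | Some m :: _ => (m, 0%N)
  | None :: l' => let: (x, y) := xy_rev l' in (x, y.+1)
  end.
Definition xy (oh : seq (obs S n)) : Mn S n * nat := xy_rev (rev oh).

(* g*_eps; for y > k (outside the domain of V~_k) y is clamped to k *)
Definition gstar (V : Mn S n -> nat -> R) : strategy :=
  fun _ oh _ => let: (x, y) := xy oh in
    let y' := minn y k in ~~ (V0 V x y' <= V1 V x y').

End Model.

(* Main.v *)
(* Exchangeability makes the empirical distribution an exact lumping of the joint
   chain, so given the history m_t has law T^y(., x), where x is the last
   non-blank observation and y its age; (x, y) is then a sufficient statistic for
   every strategy.  With C = cmax / (1 - gamma), truncating the age at k matters
   only after k + 1 - y further blanks, so V - gamma^(k+1-y) C (made nonnegative)
   is a subsolution of the untruncated Bellman inequality for all actions, and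
   V + gamma^(k+1-y) C (capped at C) is a supersolution for the action of the
   truncated policy.  Telescoping along a strategy bounds J(g) below and
   J(g*_eps) above, and at y = 0 the two bounds differ by
   2 gamma^(k+1) C <= eps. *)
Require Import Defs.
From HB Require Import structures.
From mathcomp Require Import all_boot all_order all_algebra all_fingroup.
From mathcomp Require Import all_classical all_reals all_analysis.
From mathcomp Require Import ring lra.
Import Order.TTheory GRing.Theory Num.Theory numFieldNormedType.Exports.
Local Open Scope ring_scope.

Set Implicit Arguments. Unset Strict Implicit. Unset Printing Implicit Defensive.

(** * Permutation symmetry of the dynamics *)

Section Exchangeability.
Variables (S : finType) (n : nat).
Implicit Types (s : {ffun 'I_n -> S}) (sigma : {perm 'I_n}).

Lemma emp_perm s sigma : emp [ffun i => s (sigma i)] = emp s.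
Proof.
apply: val_inj; apply/ffunP => x /=; rewrite !ffunE; congr inord.
rewrite -!sum1_card [RHS](reindex_inj (@perm_inj _ sigma)) /=.
by apply: eq_bigl => i; rewrite !inE ffunE.
Qed.

(** Equal counts make the two lists of states equal as multisets, so each fibre of [emp] is a single
    permutation orbit. *)
Lemma emp_eq_perm s s' : emp s' = emp s ->
  exists sigma, s' = [ffun i => s (sigma i)].
Proof.
move=> /(congr1 val) /ffunP /= e.
have /tuple_permP [p hp] : perm_eq [tuple s' i | i < n] [tuple s i | i < n].
  rewrite /perm_eq; apply/allP => x _ /=; apply/eqP.
  have cE u : count_mem x (map u (enum 'I_n)) = #|[pred i | u i == x]|.
    by rewrite count_map -sum1_count -sum1_card big_enum_cond.
  (* Counts are at most [n], so [inord] returns them unchanged instead of its default. *)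
  have cn u : (#|[pred i : 'I_n | u i == x]| < n.+1)%N.
    by rewrite ltnS (leq_trans (max_card _)) ?card_ord.
  rewrite !cE; move: (e x); rewrite !ffunE => /(congr1 (@nat_of_ord _)).
  by rewrite !inordK.
exists p; apply/ffunP => i; rewrite ffunE.
have /(congr1 (fun t => tnth t i)) : [tuple s' i | i < n]
    = [tuple tnth [tuple s i | i < n] (p i) | i < n] by apply: val_inj.
by rewrite !tnth_mktuple.
Qed.

Lemma next_perm (W : finType) (f : S -> Mn S n -> W -> S) s
    (w : {ffun 'I_n -> W}) sigma :
  Defs.next f [ffun i => s (sigma i)] [ffun i => w (sigma i)]
    = [ffun i => Defs.next f s w (sigma i)].
Proof. by apply/ffunP => i; rewrite !ffunE emp_perm. Qed.

End Exchangeability.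

(** * The lumped Markov chain *)

Section Chain.
Variables (R : realType) (S W : finType) (n : nat).
Variable f : S -> Mn S n -> W -> S.
Variable PW : {ffun 'I_n -> W} -> R.
Hypothesis PW_ge0 : forall w, 0 <= PW w.
Hypothesis PW_sum1 : \sum_w PW w = 1.

Lemma Tm_ge0 m m' : 0 <= Tm f PW m' m.
Proof.
rewrite divr_ge0 ?ler0n // sumr_ge0 // => s _; rewrite sumr_ge0 // => w _.
by rewrite mulr_ge0 ?ler0n.
Qed.

(* Only an inequality: when no joint state has empirical distribution [m], the
   division by zero makes the whole column of [Tm] vanish. *)
Lemma Tm_sum_le1 m : \sum_m' Tm f PW m' m <= 1.
Proof.
rewrite -mulr_suml exchange_big /=.
under eq_bigr => s _.
  rewrite exchange_big /=.
  under eq_bigr => w _.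
    rewrite -mulr_sumr (bigD1 (emp (Defs.next f s w))) //= eqxx.
    rewrite big1 ?addr0 ?mulr1; last by move=> m' /negPf; rewrite eq_sym => ->.
    over.
  rewrite PW_sum1; over.
rewrite sumr_const; case: (#|_|) => [|d]; first by rewrite mul0r ler01.
by rewrite divff // pnatr_eq0.
Qed.

Lemma Tpow_ge0 y m x : 0 <= Tpow f PW y m x.
Proof.
elim: y m => [|y IH] m /=; first exact: ler0n.
by rewrite sumr_ge0 // => m' _; rewrite mulr_ge0 ?Tm_ge0.
Qed.

Lemma Tpow_sum_le1 y x : \sum_m Tpow f PW y m x <= 1.
Proof.
elim: y => [|y IH] /=.
  rewrite (bigD1 x) //= eqxx big1 ?addr0 // => m /negPf.
  by move=> ->.
rewrite exchange_big /= (le_trans _ IH) // ler_sum // => m _.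
by rewrite -mulr_suml ler_piMl ?Tpow_ge0 ?Tm_sum_le1.
Qed.

Hypothesis PW_exch : forall (sigma : {perm 'I_n}) (w : {ffun 'I_n -> W}),
  PW [ffun i => w (sigma i)] = PW w.

(** Permuting state and noise together changes neither [PW] nor the next empirical distribution, so
    the fibre average in [Tm] runs over equal terms and any one joint state gives its value. *)
Lemma Tm_emp m s :
  Tm f PW m (emp s) = \sum_w PW w * (emp (Defs.next f s w) == m)%:R.
Proof.
rewrite /Tm; set d := #|_|.
have d0 : (d%:R : R) != 0.
  by rewrite pnatr_eq0 -lt0n; apply/card_gt0P; exists s; rewrite inE.
rewrite (eq_bigr (fun=> \sum_w PW w * (emp (Defs.next f s w) == m)%:R)).
  by rewrite sumr_const -[X in X / _]mulr_natr mulfK.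
move=> s' /eqP /emp_eq_perm [p ->].
rewrite (reindex_onto (fun w : {ffun 'I_n -> W} => [ffun i => w (p i)])
                      (fun w => [ffun i => w ((p^-1)%g i)])) /=; last first.
  by move=> w _; apply/ffunP => i; rewrite !ffunE permK.
apply: eq_big => [w|w _]; last by rewrite PW_exch next_perm emp_perm.
by apply/eqP/ffunP => i; rewrite !ffunE permKV.
Qed.

Lemma expect_next (F : Mn S n -> R) s :
  \sum_w PW w * F (emp (Defs.next f s w)) = \sum_m Tm f PW m (emp s) * F m.
Proof.
under [RHS]eq_bigr => m _ do rewrite Tm_emp mulr_suml.
rewrite exchange_big /=; apply: eq_bigr => w _.
rewrite (bigD1 (emp (Defs.next f s w))) //= eqxx mulr1.
rewrite big1 ?addr0 // => m /negPf; rewrite eq_sym => ->.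
by rewrite mulr0 mul0r.
Qed.

End Chain.

(** * Law of the history, filtering and expected costs *)

Section Law.
Variables (R : realType) (S W : finType) (n : nat).
Variable f : S -> Mn S n -> W -> S.
Variable P0 : {ffun 'I_n -> S} -> R.
Hypothesis P0_ge0 : forall s, 0 <= P0 s.
Hypothesis P0_sum1 : \sum_s P0 s = 1.
Variable PW : {ffun 'I_n -> W} -> R.
Hypothesis PW_ge0 : forall w, 0 <= PW w.
Hypothesis PW_sum1 : \sum_w PW w = 1.
Hypothesis PW_exch : forall (sigma : {perm 'I_n}) (w : {ffun 'I_n -> W}),
  PW [ffun i => w (sigma i)] = PW w.
Variable q : R.
Hypotheses (q_ge0 : 0 <= q) (q_le1 : q <= 1).
Variable mstar : Mn S n.
Variable g : strategy S n.

Local Notation T := (Tm f PW).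
Local Notation Tp := (Tpow f PW).
Local Notation lst oh := (xy mstar oh).1.
Local Notation age oh := (xy mstar oh).2.
Local Notation mu t := (law f P0 PW q g t).

Lemma xy_blank oh : xy mstar (rcons oh None) = (lst oh, (age oh).+1).
Proof. by rewrite /xy rev_rcons /=; case: (xy_rev _ _). Qed.

Lemma xy_obs oh m : xy mstar (rcons oh (Some m)) = (m, 0%N).
Proof. by rewrite /xy rev_rcons. Qed.

(** The column is indexed by an attained distribution, which excludes the degenerate case of
    [Tm_sum_le1]. *)
Lemma Tm_emp_sum1 s : \sum_m T m (emp s) = 1.
Proof.
have := expect_next f PW_exch (fun=> 1) s.
under eq_bigr do rewrite mulr1; rewrite PW_sum1 => ->.
by apply: eq_bigr => m _; rewrite mulr1.
Qed.

(** Probability that action [a] leads to a non-blank observation. *)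
Definition hit (a : bool) : R := if a then q else 0.

(** The integrand sees the joint state only through its empirical distribution, so that lumping
    applies. *)
Definition expect t (F : Mn S n -> seq (obs S n) -> seq bool -> R) : R :=
  \sum_(pc <- mu t) pc.1 * F (emp pc.2.1.1) pc.2.1.2 pc.2.2.

Lemma law_ge0 t pc : pc \in mu t -> 0 <= pc.1.
Proof.
elim: t pc => [|t IH] pc /=; first by case/mapP => s _ ->; exact: P0_ge0.
case/flatten_mapP => -[p [[s oh] ah]] /IH /= p0.
case/flatten_mapP => w _ /mapP [po hpo ->] /=.
rewrite !mulr_ge0 //; move: hpo; rewrite /obs_dist.
case: (g _ _ _); rewrite !inE; last by move/eqP => ->.
by case/orP => /eqP -> //=; rewrite subr_ge0.
Qed.

Lemma eq_expect t F G :
  (forall s oh ah, F (emp s) oh ah = G (emp s) oh ah) -> expect t F = expect t G.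
Proof. by move=> e; apply: eq_bigr => pc _; rewrite e. Qed.

Lemma le_expect t F G :
  (forall s oh ah, F (emp s) oh ah <= G (emp s) oh ah) -> expect t F <= expect t G.
Proof.
move=> e; rewrite /expect big_seq [leRHS]big_seq; apply: ler_sum => pc /law_ge0 p0.
by rewrite ler_wpM2l.
Qed.

Lemma expectD t F G :
  expect t (fun m oh ah => F m oh ah + G m oh ah) = expect t F + expect t G.
Proof. by rewrite -big_split /=; apply: eq_bigr => pc _; rewrite mulrDr. Qed.

Lemma expectZ t a F :
  expect t (fun m oh ah => a * F m oh ah) = a * expect t F.
Proof. by rewrite [RHS]mulr_sumr; apply: eq_bigr => pc _; rewrite mulrCA. Qed.

Lemma expect0 F :
  expect 0 F = \sum_s P0 s * F (emp s) [:: Some (emp s)] [::].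
Proof. by rewrite /expect /= big_map big_enum. Qed.

Lemma expectS t F :
  expect t.+1 F =
  expect t (fun m oh ah => let a := g t oh ah in
    hit a * \sum_m' T m' m * F m' (rcons oh (Some m')) (rcons ah a)) +
  expect t (fun m oh ah => let a := g t oh ah in
    (1 - hit a) * \sum_m' T m' m * F m' (rcons oh None) (rcons ah a)).
Proof.
rewrite -expectD /expect /= big_flatten big_map.
apply: eq_bigr => -[p [[s oh] ah]] _ /=; rewrite big_flatten big_map big_enum /=.
set a := g t oh ah.
rewrite -(expect_next f PW_exch (fun m' => F m' (rcons oh (Some m')) (rcons ah a))).
rewrite -(expect_next f PW_exch (fun m' => F m' (rcons oh None) (rcons ah a))).
rewrite !mulr_sumr -big_split mulr_sumr /=; apply: eq_bigr => w _.
rewrite big_map /obs_dist /hit; case: a.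
  by rewrite !big_cons big_nil /=; ring.
by rewrite big_seq1 /=; ring.
Qed.

Lemma expect_mass t : expect t (fun _ _ _ => 1) = 1.
Proof.
elim: t => [|t IH].
  by rewrite expect0 -[RHS]P0_sum1; apply: eq_bigr => s _; rewrite mulr1.
rewrite expectS -expectD -[RHS]IH; apply: eq_expect => s oh ah /=.
under eq_bigr do rewrite mulr1; rewrite Tm_emp_sum1; ring.
Qed.

Lemma expect_ge0 t F :
  (forall s oh ah, 0 <= F (emp s) oh ah) -> 0 <= expect t F.
Proof.
move=> F0; rewrite -[leLHS](mul0r (expect t F)) -expectZ.
by apply: le_expect => s oh ah; rewrite mul0r.
Qed.

Lemma expect_le t F b :
  (forall s oh ah, F (emp s) oh ah <= b) -> expect t F <= b.
Proof.
move=> Fb; rewrite -[leRHS]mulr1 -(expect_mass t) -expectZ.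
by apply: le_expect => s oh ah; rewrite mulr1.
Qed.

(* Given the history, [m_t] is distributed as [T^y(., x)]. *)
Lemma expect_filter t F :
  expect t F =
  expect t (fun _ oh ah => \sum_m Tp (age oh) m (lst oh) * F m oh ah).
Proof.
elim: t F => [|t IH] F.
  rewrite !expect0; apply: eq_bigr => s _; congr (_ * _).
  rewrite /xy /= (bigD1 (emp s)) //= eqxx mul1r.
  by rewrite big1 ?addr0 // => m /negPf ->; rewrite mul0r.
rewrite !expectS; congr (_ + _).
  apply: eq_expect => s oh ah /=; congr (_ * _); apply: eq_bigr => m _.
  congr (_ * _); rewrite xy_obs /= (bigD1 m) //= eqxx mul1r.
  by rewrite big1 ?addr0 // => m' /negPf ->; rewrite mul0r.
(* After a blank, the induction hypothesis applied to the one-step average merges [T] and [T^age]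
   into [T^(age+1)]. *)
transitivity (expect t (fun _ oh ah => let a := g t oh ah in (1 - hit a) *
    \sum_m Tp (age oh).+1 m (lst oh) * F m (rcons oh None) (rcons ah a))).
  rewrite IH; apply: eq_expect => s oh ah /=.
  under eq_bigr do rewrite mulrCA; rewrite -mulr_sumr; congr (_ * _).
  under [LHS]eq_bigr do rewrite mulr_sumr; rewrite exchange_big /=.
  by apply: eq_bigr => m _; rewrite mulr_suml; apply: eq_bigr => m' _; ring.
apply: eq_expect => s oh ah /=.
by rewrite xy_blank /= -mulr_suml Tm_emp_sum1 mul1r.
Qed.

(** This is [expect_filter] for the indicator of a state and a history; a history of mass zero is
    excluded because its posterior is 0/0. *)
Lemma post_Tpow t oh ah :
  \sum_(pc <- mu t | (pc.2.1.2 == oh) && (pc.2.2 == ah)) pc.1 != 0 ->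
  post f P0 PW q g t oh ah = [ffun m => Tp (age oh) m (lst oh)].
Proof.
move=> d0; apply/ffunP => m; rewrite !ffunE.
apply: (mulIf d0); rewrite divfK //.
pose F m' oh' ah' : R := ((m' == m) && (oh' == oh) && (ah' == ah))%:R.
transitivity (expect t F).
  rewrite big_mkcond; apply: eq_bigr => pc _.
  by rewrite /F; case: ifP; rewrite ?mulr1 ?mulr0.
rewrite expect_filter mulr_sumr [RHS]big_mkcond; apply: eq_bigr => pc _.
case: ifP => [/andP [/eqP -> /eqP ->]|e].
  rewrite mulrC (bigD1 m) //= /F !eqxx mulr1 big1 ?addr0 // => m' /negPf ->.
  by rewrite mulr0.
by rewrite big1 ?mulr0 // => m' _; rewrite /F -andbA e andbF mulr0.
Qed.

Variable c : Mn S n -> Mn S n -> bool -> R.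
Variable h : {ffun Mn S n -> R} -> Mn S n.
Variable gamma : R.

Definition step_cost x y a : R :=
  \sum_m Tp y m x * c m (h [ffun m1 => Tp y m1 x]) a.

Lemma Ecost_step_cost t :
  Ecost f P0 PW q c h g t =
  expect t (fun _ oh ah => step_cost (lst oh) (age oh) (g t oh ah)).
Proof.
rewrite -(expect_filter t (fun m oh ah =>
  c m (h [ffun m1 => Tp (age oh) m1 (lst oh)]) (g t oh ah))).
rewrite /Ecost /expect big_seq [RHS]big_seq; apply: eq_bigr => pc pcin.
set d := \sum_(pc' <- mu t | (pc'.2.1.2 == pc.2.1.2) && (pc'.2.2 == pc.2.2)) pc'.1.
(* On a history of mass zero the posterior may be wrong, but every configuration there has weight
   zero. *)
have [d0|d0] := eqVneq d 0; last by rewrite post_Tpow.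
suff -> : pc.1 = 0 by rewrite !mul0r.
move/eqP: d0; rewrite /d big_seq_cond psumr_eq0 => [|pc' /andP [/law_ge0]] //.
by move=> /allP /(_ pc pcin); rewrite pcin !eqxx /= => /eqP.
Qed.

(** Right-hand side of the untruncated Bellman equation for a fixed action: a blank always leads to
    age [y.+1], never to [mstar]. *)
Definition bellman (F : Mn S n -> nat -> R) x y a : R :=
  step_cost x y a +
  gamma * (hit a * (\sum_m Tp y.+1 m x * F m 0%N) + (1 - hit a) * F x y.+1).

(** One telescoping step: the statistic [(x, y)] moves to [(m', 0)] on an observation and to
    [(x, y+1)] on a blank. *)
Lemma Ecost_bellman t F :
  Ecost f P0 PW q c h g t +
    gamma * expect t.+1 (fun _ oh _ => F (lst oh) (age oh)) =
  expect t (fun _ oh ah => bellman F (lst oh) (age oh) (g t oh ah)).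
Proof.
rewrite /bellman expectD -Ecost_step_cost expectZ expectD expectS.
congr (_ + _ * (_ + _)).
  rewrite expect_filter; apply: eq_expect => s oh ah /=.
  under eq_bigr do rewrite mulrCA; rewrite -mulr_sumr; congr (_ * _).
  under [LHS]eq_bigr do rewrite mulr_sumr; rewrite exchange_big /=.
  apply: eq_bigr => m _; rewrite mulr_suml; apply: eq_bigr => m' _.
  by rewrite xy_obs /=; ring.
apply: eq_expect => s oh ah /=.
by rewrite xy_blank /= -mulr_suml Tm_emp_sum1 mul1r.
Qed.

Hypothesis gamma_ge0 : 0 <= gamma.

Local Notation cost N := (\sum_(0 <= t < N) gamma ^+ t * Ecost f P0 PW q c h g t).

Lemma subsolution_le_cost F N :
  (forall x y a, F x y <= bellman F x y a) ->
  expect 0 (fun _ oh _ => F (lst oh) (age oh)) <=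
  cost N + gamma ^+ N * expect N (fun _ oh _ => F (lst oh) (age oh)).
Proof.
move=> sub; elim: N => [|N IH]; first by rewrite big_nil add0r mul1r.
apply: (le_trans IH); rewrite big_nat_recr //= -addrA lerD2l exprSr -mulrA -mulrDr.
by rewrite ler_wpM2l ?exprn_ge0 // Ecost_bellman le_expect.
Qed.

(** The inequality is required only for the actions that [g] takes, so a policy minimising the
    truncated equation can satisfy it. *)
Lemma cost_le_supersolution F N :
  (forall t oh ah, bellman F (lst oh) (age oh) (g t oh ah) <= F (lst oh) (age oh)) ->
  cost N + gamma ^+ N * expect N (fun _ oh _ => F (lst oh) (age oh)) <=
  expect 0 (fun _ oh _ => F (lst oh) (age oh)).
Proof.
move=> sup; elim: N => [|N IH]; first by rewrite big_nil add0r mul1r.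
apply: le_trans IH; rewrite big_nat_recr //= -addrA lerD2l exprSr -mulrA -mulrDr.
by rewrite ler_wpM2l ?exprn_ge0 // Ecost_bellman le_expect.
Qed.

Variable cmax : R.
Hypothesis c_ge0 : forall m mh a, 0 <= c m mh a.
Hypothesis c_le : forall m mh a, c m mh a <= cmax.

Lemma step_cost_ge0 x y a : 0 <= step_cost x y a.
Proof. by rewrite sumr_ge0 // => m _; rewrite mulr_ge0 ?Tpow_ge0. Qed.

Lemma step_cost_le x y a : step_cost x y a <= cmax.
Proof.
have cmax_ge0 : 0 <= cmax := le_trans (c_ge0 x x a) (c_le x x a).
apply: (@le_trans _ _ (\sum_m Tp y m x * cmax)).
  by apply: ler_sum => m _; rewrite ler_wpM2l ?Tpow_ge0.
by rewrite -mulr_suml ler_piMl ?Tpow_sum_le1.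
Qed.

Lemma Ecost_ge0 t : 0 <= Ecost f P0 PW q c h g t.
Proof.
by rewrite Ecost_step_cost expect_ge0 // => s oh ah; rewrite step_cost_ge0.
Qed.

End Law.

(** * The truncated Bellman equation and its comparison functions *)

Section Truncation.
Variables (R : realType) (S W : finType) (n : nat).
Variable f : S -> Mn S n -> W -> S.
Variable PW : {ffun 'I_n -> W} -> R.
Hypothesis PW_ge0 : forall w, 0 <= PW w.
Hypothesis PW_sum1 : \sum_w PW w = 1.
Variable q : R.
Hypotheses (q_ge0 : 0 <= q) (q_le1 : q <= 1).
Variable c : Mn S n -> Mn S n -> bool -> R.
Variable h : {ffun Mn S n -> R} -> Mn S n.
Variable gamma : R.
Hypotheses (gamma_gt0 : 0 < gamma) (gamma_lt1 : gamma < 1).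
Variable cmax : R.
Hypothesis c_ge0 : forall m mh a, 0 <= c m mh a.
Hypothesis c_le : forall m mh a, c m mh a <= cmax.
Variables (k : nat) (mstar : Mn S n) (V : Mn S n -> nat -> R).
Hypothesis hV : forall x y, (y <= k)%N ->
  V x y = Num.min (V0 f PW c h gamma k mstar V x y)
                  (V1 f PW q c h gamma k mstar V x y).

Local Notation Tp := (Tpow f PW).
Local Notation bell := (bellman f PW q c h gamma).
Local Notation scost := (step_cost f PW c h).
Local Notation cont := (contV k mstar V).

(* The common comparison step: shifting the values by [D >= 0] shifts an average
   by at most [D], also when [Tp] is only substochastic. *)
Lemma average_shift (F G : Mn S n -> R) (u v D : R) y x a : 0 <= D ->
    (forall m, F m <= G m + D) -> u <= v + D ->
  hit q a * (\sum_m Tp y m x * F m) + (1 - hit q a) * u <=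
  hit q a * (\sum_m Tp y m x * G m) + (1 - hit q a) * v + D.
Proof.
move=> D0 FG uv.
have [h0 h1] : 0 <= hit q a /\ 0 <= 1 - hit q a.
  by rewrite /hit; case: a; split; rewrite ?subr_ge0 ?subr0 ?ler01.
have sFG : \sum_m Tp y m x * F m <= \sum_m Tp y m x * G m + D.
  apply: (@le_trans _ _ (\sum_m Tp y m x * (G m + D))).
    by apply: ler_sum => m _; rewrite ler_wpM2l ?Tpow_ge0.
  under eq_bigr do rewrite mulrDr.
  by rewrite big_split /= -mulr_suml lerD2l ler_piMl ?Tpow_sum_le1.
have := lerD (ler_wpM2l h0 sFG) (ler_wpM2l h1 uv); lra.
Qed.

(** Common form of [V0] and [V1]; it differs from [bellman] at [V] only in the value after a
    blank. *)
Definition trunc_bellman x y a : R :=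
  scost x y a +
  gamma * (hit q a * (\sum_m Tp y.+1 m x * V m 0%N) + (1 - hit q a) * cont x y).

Lemma V0_trunc x y : V0 f PW c h gamma k mstar V x y = trunc_bellman x y false.
Proof.
rewrite /V0 /trunc_bellman /hit mul0r add0r subr0 mul1r; congr (_ + _).
by apply: eq_bigr => m _; rewrite mulrC.
Qed.

Lemma V1_trunc x y : V1 f PW q c h gamma k mstar V x y = trunc_bellman x y true.
Proof.
rewrite /V1 /trunc_bellman /hit /step_cost.
have -> : \sum_m Tp y m x * c m (h [ffun m1 => Tp y m1 x]) true =
    \sum_m c m (h [ffun m1 => Tp y m1 x]) true * Tp y m x.
  by apply: eq_bigr => m _; rewrite mulrC.
by move: (contV k mstar V x y) => u; ring.
Qed.

Lemma V_le_trunc x y a : (y <= k)%N -> V x y <= trunc_bellman x y a.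
Proof.
move=> yk; rewrite hV // V0_trunc V1_trunc; case: a; rewrite ge_min lexx //.
by rewrite orbT.
Qed.

Lemma V_trunc_choice x y : (y <= k)%N ->
  V x y = trunc_bellman x y (~~ (V0 f PW c h gamma k mstar V x y
                                 <= V1 f PW q c h gamma k mstar V x y)).
Proof.
move=> yk; rewrite hV // V0_trunc V1_trunc.
by case: leP.
Qed.

Lemma contVE x y : (y <= k)%N ->
  cont x y = if (y < k)%N then V x y.+1 else V mstar 0%N.
Proof.
move=> yk; rewrite /contV; case: ltngtP yk => // _ _.
  by rewrite mul1r mul0r addr0.
by rewrite mul0r mul1r add0r.
Qed.

Let gamma_ge0 : 0 <= gamma. Proof. exact: ltW. Qed.

Local Notation C := (cmax / (1 - gamma)).

Let cmaxE : cmax = (1 - gamma) * C.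
Proof. by rewrite mulrC divfK // subr_eq0 gt_eqF. Qed.

Let C_ge0 : 0 <= C.
Proof.
rewrite divr_ge0 ?subr_ge0 ?(ltW gamma_lt1) //.
exact: le_trans (c_ge0 mstar mstar true) (c_le _ _ _).
Qed.

(** Minimum principle: costs are nonnegative and continuation values are at least the minimum [b],
    so [b < 0] would give [b >= gamma * b > b]. *)
Lemma V_ge0 x y : (y <= k)%N -> 0 <= V x y.
Proof.
pose F (p : Mn S n * 'I_k.+1) := V p.1 p.2.
case: (arg_minP F (erefl : predT (mstar, ord0))) => p _ pmin.
have minV x' y' : (y' <= k)%N -> F p <= V x' y'.
  by move=> y'k; apply: (pmin (x', Ordinal (y'k : (y' < k.+1)%N))).
move=> yk; apply: le_trans (minV x y yk); rewrite leNgt; apply/negP => b0.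
have pk : (p.2 <= k)%N by rewrite -ltnS.
have cb : F p <= cont p.1 p.2 by rewrite contVE //; case: ifP => ?; rewrite minV.
set a := ~~ (V0 f PW c h gamma k mstar V p.1 p.2
             <= V1 f PW q c h gamma k mstar V p.1 p.2).
have b0' : 0 <= - F p by rewrite oppr_ge0 ltW.
have Vb m : 0 <= V m 0%N + - F p by rewrite subr_ge0 minV.
have cb' : 0 <= cont p.1 p.2 + - F p by rewrite subr_ge0.
have := average_shift p.2.+1 p.1 a b0' Vb cb'.
rewrite big1 ?mulr0 ?addr0 => [|m _]; last by rewrite mulr0.
move=> /(ler_wpM2l gamma_ge0); have := V_trunc_choice p.1 pk; rewrite -/a.
have := step_cost_ge0 f PW_ge0 h c_ge0 p.1 p.2 a.
rewrite /trunc_bellman -/(F p) => s0 Fp /=.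
have : 0 < (1 - gamma) * - F p by rewrite mulr_gt0 ?subr_gt0 ?oppr_gt0.
rewrite /= in Fp *; lra.
Qed.

(** Maximum principle: the maximum [b] satisfies [b <= cmax + gamma * b]. One fixed action suffices,
    since [V] lies below both branches. *)
Lemma V_le x y : (y <= k)%N -> V x y <= C.
Proof.
pose F (p : Mn S n * 'I_k.+1) := V p.1 p.2.
case: (arg_maxP F (erefl : predT (mstar, ord0))) => p _ pmax.
have maxV x' y' : (y' <= k)%N -> V x' y' <= F p.
  by move=> y'k; apply: (pmax (x', Ordinal (y'k : (y' < k.+1)%N))).
move=> yk; apply: (le_trans (maxV x y yk)).
have pk : (p.2 <= k)%N by rewrite -ltnS.
have cb : cont p.1 p.2 <= 0 + F p.
  by rewrite add0r contVE //; case: ifP => ?; rewrite maxV.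
have Vb m : V m 0%N <= 0 + F p by rewrite add0r maxV.
have := average_shift p.2.+1 p.1 false (V_ge0 p.1 pk) Vb cb.
rewrite [X in _ <= _ * X + _ + _]big1 ?mulr0 ?addr0 => [|m _]; last by rewrite mulr0.
move=> /(ler_wpM2l gamma_ge0); have := V_le_trunc p.1 false pk.
have := step_cost_le f PW_ge0 PW_sum1 h c_ge0 c_le p.1 p.2 false.
rewrite /trunc_bellman -/(F p) add0r => s0 Fp av.
rewrite ler_pdivlMr ?subr_gt0 //; lra.
Qed.

(* Bounds the effect of the jump to [mstar], which happens after
   [k + 1 - y] more blanks at the earliest. *)
Definition disc y : R := gamma ^+ (k.+1 - y) * C.

Lemma disc_ge0 y : 0 <= disc y.
Proof. by rewrite mulr_ge0 ?exprn_ge0 ?gamma_ge0 ?C_ge0. Qed.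

Lemma disc_step y : (y <= k)%N -> disc y = gamma * disc y.+1.
Proof. by move=> yk; rewrite /disc subSS subSn // exprS -mulrA. Qed.

(** An observation resets the age to 0, where the correction is smallest, so the shift allowed after
    a blank also covers this case. *)
Lemma disc0_le y : disc 0 <= disc y.
Proof.
rewrite ler_wpM2r ?C_ge0 // ler_wiXn2l ?gamma_ge0 ?(ltW gamma_lt1) //.
by rewrite subn0 leq_subr.
Qed.

(** Beyond age [k] the equation says nothing about [V], and the trivial bounds 0 and [C] take
    over. *)
Definition lower x y := if (y <= k)%N then Num.max 0 (V x y - disc y) else 0.
Definition upper x y := if (y <= k)%N then Num.min C (V x y + disc y) else C.

Lemma lower_ge0 x y : 0 <= lower x y.
Proof. by rewrite /lower; case: ifP => _; rewrite ?le_max lexx. Qed.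

Lemma lower_le x y : lower x y <= C.
Proof.
rewrite /lower; case: ifP => yk; last exact: C_ge0.
rewrite ge_max C_ge0 /= lerBlDr (le_trans (V_le x yk)) // lerDl disc_ge0 //.
Qed.

Lemma upper_le x y : upper x y <= C.
Proof. by rewrite /upper; case: ifP => _; rewrite ?ge_min lexx. Qed.

Lemma upper_ge0 x y : 0 <= upper x y.
Proof.
rewrite /upper; case: ifP => yk; last exact: C_ge0.
by rewrite le_min C_ge0 addr_ge0 ?V_ge0 ?disc_ge0.
Qed.

Lemma bellman_ge0 F x y a : (forall x' y', 0 <= F x' y') -> 0 <= bell F x y a.
Proof.
move=> F0; have := @average_shift (fun=> 0) (F ^~ 0%N) 0 (F x y.+1) 0 y.+1 x a.
rewrite big1 ?mulr0 ?addr0 => [|m _]; last by rewrite mulr0.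
move=> /(_ (lexx _)) av; apply: addr_ge0; first exact: step_cost_ge0.
apply: mulr_ge0; first exact: gamma_ge0.
by apply: av => [m|]; rewrite ?addr0.
Qed.

Lemma bellman_le F x y a : (forall x' y', F x' y' <= C) -> bell F x y a <= C.
Proof.
move=> FC; have := @average_shift (F ^~ 0%N) (fun=> 0) (F x y.+1) 0 C y.+1 x a.
rewrite [X in _ <= _ * X + _ + _]big1 ?mulr0 ?addr0 => [|m _]; last by rewrite mulr0.
rewrite !add0r => /(_ C_ge0) av.
have := ler_wpM2l gamma_ge0 (av (fun m => FC m 0%N) (FC x y.+1)).
have := step_cost_le f PW_ge0 PW_sum1 h c_ge0 c_le x y a.
rewrite {1}cmaxE /bellman; lra.
Qed.

Lemma lower_sub x y a : lower x y <= bell lower x y a.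
Proof.
have L0 := bellman_ge0 x y a lower_ge0.
rewrite {1}/lower; case: ifP => // yk; rewrite ge_max L0 /= lerBlDr.
apply: (le_trans (V_le_trunc x a yk)); rewrite disc_step // -addrA lerD2l -mulrDr.
rewrite ler_wpM2l ?gamma_ge0 // average_shift ?disc_ge0 // => [m|].
  rewrite /lower leq0n -lerBlDr le_max; apply/orP; right.
  by rewrite lerD2l lerN2 disc0_le.
rewrite contVE // /lower; case: ifP => yk'.
  by rewrite -lerBlDr le_max lexx orbT.
(* At the cut-off [lower] continues with 0 and the truncated equation with [V mstar 0]; the allowed
   shift [disc k.+1] equals [C], which covers the difference. *)
have -> : y = k by apply/eqP; rewrite eqn_leq yk leqNgt yk'.
by rewrite add0r /disc subnn mul1r V_le.
Qed.

(** For [y <= k] the clamped action attains the minimum defining [V]; for [y > k] the bound [C]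
    holds under any action, so clamping is harmless. *)
Lemma upper_super x y :
  bell upper x y (~~ (V0 f PW c h gamma k mstar V x (minn y k)
                      <= V1 f PW q c h gamma k mstar V x (minn y k)))
  <= upper x y.
Proof.
set a := ~~ _; have UC := bellman_le x y a upper_le.
rewrite {2}/upper; case: ifP => // yk; rewrite le_min UC /=.
have -> : V x y = trunc_bellman x y a.
  by rewrite (V_trunc_choice x yk) /a (minn_idPl yk).
rewrite disc_step // -addrA lerD2l -mulrDr.
rewrite ler_wpM2l ?gamma_ge0 // average_shift ?disc_ge0 // => [m|].
  by rewrite /upper leq0n ge_min lerD2l disc0_le orbT.
rewrite contVE // /upper; case: ifP => yk'; first by rewrite ge_min lexx orbT.
have -> : y = k by apply/eqP; rewrite eqn_leq yk leqNgt yk'.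
by rewrite /disc subnn mul1r lerDr V_ge0.
Qed.

Lemma upper_lower_gap x : upper x 0 <= lower x 0 + 2 * disc 0.
Proof.
rewrite /upper /lower leq0n (@le_trans _ _ (V x 0 + disc 0)) ?ge_min ?lexx ?orbT //.
by rewrite -lerBlDr le_max; apply/orP; right; lra.
Qed.

End Truncation.

(* For [cmax = 0] the hypothesis is vacuous ([ln 0 = 0]) but the bound is trivial. *)
Lemma expr_le_of_ln (R : realType) (gamma eps cmax : R) (k : nat) :
  0 < gamma -> gamma < 1 -> 0 < eps -> 0 <= cmax ->
  ln ((1 - gamma) * eps / (2 * cmax)) / ln gamma <= k%:R ->
  2 * (gamma ^+ k * cmax) <= (1 - gamma) * eps.
Proof.
move=> g0 g1 e0; rewrite le_eqVlt => /predU1P [<- _|c0].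
  by rewrite !mulr0 mulr_ge0 ?subr_ge0 ?ltW.
have r0 : 0 < (1 - gamma) * eps / (2 * cmax).
  by rewrite divr_gt0 ?mulr_gt0 ?subr_gt0.
rewrite ler_ndivrMr ?ln_lt0 ?g0 // [k%:R * _]mulr_natl -lnXn //
  ler_ln ?posrE ?exprn_gt0 //.
by rewrite ler_pdivlMr ?mulr_gt0 // mulrCA.
Qed.

(** * Comparison of the discounted costs *)

Unset Implicit Arguments.

Theorem theorem4 (R : realType) (S W : finType) (n : nat) (n_gt0 : (0 < n)%N)
  (f : S -> Mn S n -> W -> S)
  (P0 : {ffun 'I_n -> S} -> R) (P0_ge0 : forall s, 0 <= P0 s)
  (P0_sum1 : \sum_(s : {ffun 'I_n -> S}) P0 s = 1)
  (PW : {ffun 'I_n -> W} -> R) (PW_ge0 : forall w, 0 <= PW w)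
  (PW_sum1 : \sum_(w : {ffun 'I_n -> W}) PW w = 1)
  (PW_exch : forall (sigma : {perm 'I_n}) (w : {ffun 'I_n -> W}),
      PW [ffun i => w (sigma i)] = PW w)
  (q : R) (q_ge0 : 0 <= q) (q_le1 : q <= 1)
  (gamma : R) (gamma_gt0 : 0 < gamma) (gamma_lt1 : gamma < 1)
  (c : Mn S n -> Mn S n -> bool -> R) (c_ge0 : forall m mh a, 0 <= c m mh a)
  (cmax : R) (c_le : forall m mh a, c m mh a <= cmax)
  (h : {ffun Mn S n -> R} -> Mn S n)
  (eps : R) (eps_gt0 : 0 < eps)
  (k : nat) (hk : ln ((1 - gamma) * eps / (2 * cmax)) / ln gamma <= k%:R)
  (mstar : Mn S n)
  (V : Mn S n -> nat -> R)
  (hV : forall (x : Mn S n) (y : nat), (y <= k)%N ->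
      V x y = Num.min (V0 f PW c h gamma k mstar V x y)
                      (V1 f PW q c h gamma k mstar V x y)) :
  forall g : strategy S n,
    J f P0 PW q c h gamma (gstar f PW q c h gamma k mstar V)
      <= J f P0 PW q c h gamma g + eps.
Proof.
move=> g.
have cmax0 : 0 <= cmax := le_trans (c_ge0 mstar mstar true) (c_le _ _ _).
(* The hypothesis on [k] controls [gamma ^+ k]; [disc] at 0 carries one more factor [gamma <= 1]. *)
have gap : 2 * disc gamma cmax k 0 <= eps.
  have := expr_le_of_ln gamma_gt0 gamma_lt1 eps_gt0 cmax0 hk.
  rewrite /disc subn0 exprS !mulrA ler_pdivrMr ?subr_gt0 // => gk.
  have := ler_wpM2l (ltW gamma_gt0) gk.
  have : 0 <= (1 - gamma) * ((1 - gamma) * eps).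
    by rewrite !mulr_ge0 ?subr_ge0 ?ltW.
  lra.
set C := cmax / (1 - gamma).
pose lo := lower gamma cmax k V; pose up := upper gamma cmax k V.
pose gs := gstar f PW q c h gamma k mstar V.
(* The first statistic is [(m_1, 0)] under every strategy, so both bounds start from the same
   average. *)
pose start F : R := \sum_s P0 s * F (emp s) 0%N.
have startE g' F : expect f P0 PW q g' 0
    (fun _ oh _ => F (xy mstar oh).1 (xy mstar oh).2) = start F.
  by rewrite expect0.
pose cost g' := series (fun t => gamma ^+ t * Ecost f P0 PW q c h g' t).
have cost_le_start g' F N : (forall x y, 0 <= F x y) ->
    (forall t oh ah,
      bellman f PW q c h gamma F (xy mstar oh).1 (xy mstar oh).2 (g' t oh ah)
      <= F (xy mstar oh).1 (xy mstar oh).2) ->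
    cost g' N <= start F.
  move=> F0 /(cost_le_supersolution P0_ge0 PW_ge0 PW_sum1 PW_exch q_ge0 q_le1
    (ltW gamma_gt0) N); rewrite startE; apply: le_trans.
  by rewrite lerDl mulr_ge0 ?exprn_ge0 ?(ltW gamma_gt0) // expect_ge0.
have C0 : 0 <= C by rewrite divr_ge0 // subr_ge0 ltW.
have cvg_cost g' : cvgn (cost g').
  apply: nondecreasing_is_cvgn.
    apply/nondecreasing_seqP => N; rewrite /cost seriesSr lerDl mulr_ge0 //.
      by rewrite exprn_ge0 // ltW.
    exact: Ecost_ge0.
  (* The constant [C] is a supersolution for every action, which bounds the nondecreasing partial
     sums. *)
  exists (start (fun _ _ => C)) => _ [N _ <-]; apply: cost_le_start => // t oh ah.
  exact: bellman_le.
(* The last term bounds the remainder of the telescoped subsolution, as [lower] is at most [C]; it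
   vanishes in the limit. *)
have cost_gs N : cost gs N <= cost g N + eps + gamma ^+ N * C.
  apply: (@le_trans _ _ (start up)).
    apply: cost_le_start => [x y|t oh ah].
      exact: (upper_ge0 _ _ _ _ _ _ _ _ hV).
    rewrite /gs /gstar; case: (xy mstar oh) => x y.
    exact: (upper_super _ _ _ _ _ _ _ _ hV).
  apply: (@le_trans _ _ (start lo + eps)).
    rewrite -[leRHS]addrC -[eps]mul1r -P0_sum1 mulr_suml -big_split /=.
    apply: ler_sum => s _; rewrite -mulrDr ler_wpM2l // addrC.
    by rewrite (le_trans (upper_lower_gap _ _ _ _ _)) // lerD2l.
  rewrite -addrA [eps + _]addrC addrA lerD2r -(startE g).
  apply: le_trans (subsolution_le_cost P0_ge0 PW_ge0 PW_sum1 PW_exch q_ge0 q_le1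
    mstar g (ltW gamma_gt0) N (lower_sub PW_ge0 PW_sum1 q_ge0 q_le1 gamma_gt0
    gamma_lt1 c_ge0 c_le hV)) _.
  rewrite lerD2l ler_wpM2l ?exprn_ge0 ?(ltW gamma_gt0) // expect_le // => s oh ah.
  exact: (lower_le _ _ _ _ _ _ _ _ hV).
rewrite -[J _ _ _ _ _ _ _ g + eps]addr0.
apply: (ler_cvg_to (cvg_cost gs)); last exact: nearW cost_gs.
apply: cvgD; first by apply: cvgD; [exact: cvg_cost | exact: cvg_cst].
rewrite -[0](mul0r C); apply: cvgMl; apply: cvg_expr.
by rewrite gtr0_norm.
Qed.
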